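(* Let $I\subseteq N$ with $|I|=k$ and let $F\in\mathcal F_{q-k+1}$. Then $$\widehat\chi_F(I)\in\{0,+1,-1\},$$ and $$\widehat\chi_F(I)\neq0\quad\Longleftrightarrow\quad N\setminus I\text{ is a spanning tree of }H_F.$$ Moreover, $$\widehat\chi_F(I)=(-1)^{k(q+1)}\,\varepsilon_N(I)\,\chi_F(N\setminus I).$$
   Context: Network. $G=(V,E)$ is a finite connected simple undirected graph. A spanning forest $F$ of $G$ is an acyclic subgraph with vertex set $V$ (isolated vertices allowed); $\mathcal F_m$ is the set of spanning forests with exactly $m$ connected components. Matrix conventions. $A[S,T]$ is the submatrix with rows $S$ and columns $T$ in inherited order; $A[:,T]$ keeps all rows; empty determinants equal $1$. Superports. The boundary $M\subseteq V$ is nonempty and partitioned into nonempty superports $M=A_1\sqcup\cdots\sqcup A_p$. Choose a root $r_a\in A_a$ for each $a$; $R=\{r_1,\dots,r_p\}$, $N=M\setminus R$, $q=|N|$, $N=(x_1,\dots,x_q)$ in a fixed order; $r(x)$ is the root of the superport containing $x$. Fix a ground root $g\in R$. In $\mathbb R^{V\setminus\{g\}}$ with standard basis $(e_v)$ and the convention $e_g=0$, let $D$ be the matrix whose columns are $d_x=e_x-e_{r(x)}$, $x\in N$, in the fixed order. Quotient port graph. For a spanning forest $F$ with $s\ge1$ components, let $C_0(F)$ be the component containing $g$ and order the others as $C_1(F),\dots,C_{s-1}(F)$. The quotient port multigraph $H_F$ has the components of $F$ as vertices, and each $x\in N$ gives a directed edge from the component containing $r(x)$ to the component containing $x$ (a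 loop if these coincide); subsets of $N$ are thereby regarded as edge sets of $H_F$. Let $Q_F$ be the $(s-1)\times(|V|-1)$ matrix with columns indexed by $V\setminus\{g\}$ and $(Q_F)_{a,v}=1$ if $v\in C_a(F)$, $0$ otherwise ($1\le a\le s-1$), and $B_F=Q_FD$. For $S\subseteq N$ with $|S|=s-1$, $\chi_F(S)=\det B_F[:,S]$, with $\chi_F(\varnothing)=1$ when $s=1$. Completed determinant. For $I\subseteq N$, $|I|=k$, let $E_I$ be the $q\times k$ matrix whose columns are the standard basis vectors of $\mathbb R^N$ indexed by $I$, in inherited order. For $F\in\mathcal F_{q-k+1}$, $\widehat\chi_F(I)=\det\begin{pmatrix}B_F \\ E_I^T\end{pmatrix}$, a $q\times q$ determinant. Orientation sign. For an ordered finite set $U$ and $S=\{s_1<\cdots<s_r\}\subseteq U$, $\varepsilon_U(S)=(-1)^{\sum_{a=1}^r\operatorname{pos}_U(s_a)-r(r+1)/2}$, where $\operatorname{pos}_U$ denotes one-based position in $U$. *)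

(* Defs.v *)
From HB Require Import structures.
From mathcomp Require Import all_boot all_order all_algebra.
From mathcomp Require Import reals.

Set Implicit Arguments.
Unset Strict Implicit.
Unset Printing Implicit Defensive.
Import Order.TTheory GRing.Theory Num.Theory.

Local Open Scope ring_scope.

(* A graph on a finite vertex type V is given by its adjacency relation. *)
Section Graphs.
Variable V : finType.
Implicit Types e f : rel V.

Definition simple_graph e : Prop := symmetric e /\ irreflexive e.

Definition connected_graph e : Prop := forall u v, connect e u v.

Definition components f : {set {set V}} :=
  equivalence_partition (connect f) [set: V].

(* Cyclic sequences of length at most 2 only retrace a single edge. *)
Definition acyclic_graph f : Prop :=
  forall c : seq V, (2 < size c)%N -> cycle f c -> ~~ uniq c.

Definition spanning_forest e (s : nat) f : Prop :=
  [/\ symmetric f, subrel f e, acyclic_graph f & #|components f| = s].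

(* Any numbering C_0, C_1, C_2 and so on of the components of f is allowed,
   provided that C_0 is the component containing g. *)
Definition component_numbering f (g : V) m (C : 'I_m.+1 -> {set V}) : Prop :=
  [/\ injective C, [set C a | a : 'I_m.+1] = components f & g \in C ord0].

End Graphs.

Record multigraph (W E : finType) := Multigraph {
  mg_vertices : {set W};
  mg_src : E -> W;
  mg_tgt : E -> W
}.

Section Multigraphs.
Variables (W E : finType) (H : multigraph W E).
Implicit Type T : {set E}.

(* A step (x, b) traverses the edge x forwards if b = true, and backwards
   otherwise: trees and cycles ignore the orientation of the edges. *)
Definition step_src (st : E * bool) : W :=
  if st.2 then mg_src H st.1 else mg_tgt H st.1.

Definition step_tgt (st : E * bool) : W :=
  if st.2 then mg_tgt H st.1 else mg_src H st.1.

Definition mg_adj T : rel W := fun u v =>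
  [exists st : E * bool, [&& st.1 \in T, step_src st == u & step_tgt st == v]].

Definition mg_connected T : Prop :=
  {in mg_vertices H &, forall u v, connect (mg_adj T) u v}.

(* Loops are cycles of length 1, and two parallel edges form a cycle of
   length 2. *)
Definition mg_cycle T (c : seq (E * bool)) : Prop :=
  [/\ c != [::],
      all (fun st => st.1 \in T) c,
      cycle (fun st st' => step_tgt st == step_src st') c,
      uniq (map step_src c) &
      uniq (map fst c)].

Definition mg_acyclic T : Prop := forall c, ~ mg_cycle T c.

Definition mg_spanning_tree T : Prop := mg_connected T /\ mg_acyclic T.

End Multigraphs.

(* The superports are the blocks of a partition P of the boundary M, and
   root A is the chosen root of the superport A. *)
Section Superports.
Variables (V : finType) (P : {set {set V}}) (root : {set V} -> V).

Definition port_roots : {set V} := [set root A | A in P].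

Definition port_root (v : V) : V := root (pblock P v).

End Superports.

(* N = (x_0, x_1, up to x_(q-1)) is given by an injection x : 'I_q -> V, and
   subsets of N are given by the corresponding sets of indices, so that
   enum_val lists them in inherited order. *)
Section PortMatrices.
Variables (R : realType) (V : finType) (P : {set {set V}}).
Variables (root : {set V} -> V) (g : V) (q : nat) (x : 'I_q -> V).

Definition quotient_port_graph (f : rel V) : multigraph {set V} 'I_q :=
  Multigraph (components f)
    (fun i => pblock (components f) (port_root P root (x i)))
    (fun i => pblock (components f) (x i)).

(* Rows are indexed by V \ {g}, enumerated by enum_val; this builds in the
   convention e_g = 0. *)
Definition port_mx : 'M[R]_(#|[set~ g]|, q) :=
  \matrix_(v, i) ((enum_val v == x i)%:R
                  - (enum_val v == port_root P root (x i))%:R).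

Definition indicator_mx m (C : 'I_m.+1 -> {set V}) : 'M[R]_(m, #|[set~ g]|) :=
  \matrix_(a, v) (enum_val v \in C (lift ord0 a))%:R.

Definition quotient_mx m (C : 'I_m.+1 -> {set V}) : 'M[R]_(m, q) :=
  indicator_mx C *m port_mx.

Definition chi m (C : 'I_m.+1 -> {set V}) (S : {set 'I_q}) (hS : #|S| = m) : R :=
  \det (castmx (erefl m, hS)
          (colsub (fun j : 'I_#|S| => enum_val j) (quotient_mx C))).

Definition basis_mx (I : {set 'I_q}) : 'M[R]_(q, #|I|) :=
  \matrix_(i, j) (i == enum_val j)%:R.

Definition chi_hat m (C : 'I_m.+1 -> {set V}) (I : {set 'I_q})
    (hI : (m + #|I|)%N = q) : R :=
  \det (castmx (hI, erefl q) (col_mx (quotient_mx C) (basis_mx I)^T)).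

(* The subtraction in nat never truncates, since r distinct positive
   integers sum to at least r (r + 1) / 2. *)
Definition orientation_sign (S : {set 'I_q}) : R :=
  (-1) ^+ (\sum_(i in S) i.+1 - (#|S| * #|S|.+1)./2).

End PortMatrices.

Lemma subn_card_ordK q (I : {set 'I_q}) : (q - #|I| + #|I|)%N = q.
Proof. by rewrite subnK // -[leqRHS]card_ord max_card. Qed.

Lemma card_setC_ord q (I : {set 'I_q}) : #|~: I| = (q - #|I|)%N.
Proof. by rewrite cardsCs setCK card_ord. Qed.

(* Main.v *)
(* The columns of the completed matrix are reordered so that those outside I
   come first: it becomes block triangular with blocks B_F[:, N \ I] and an
   identity, and the sign of the reordering is counted by its inversions.

   The matrix B_F[:, N \ I] is the incidence matrix of the edges N \ I of H_F
   with the row of C_0 removed.  If these edges connect H_F, the walks from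
   C_0 to the other vertices give the columns of an integral right inverse, so
   the determinant is a unit of the integers.  If they do not, the indicator of
   the vertices that C_0 does not reach is in the left kernel; and the signed
   sum of the edges of a cycle is in the right kernel. *)

Require Import Defs.
From HB Require Import structures.
From mathcomp Require Import all_boot all_order all_algebra fingroup perm zify.
From mathcomp Require Import reals.

Set Implicit Arguments.
Unset Strict Implicit.
Unset Printing Implicit Defensive.
Import Order.TTheory GRing.Theory Num.Theory.

Local Open Scope ring_scope.

(** * Inversion signs and determinants completed by basis rows *)

(* Both sides are the sign of the Vandermonde determinant of the nodes s 0, s 1,
   s 2 and so on. *)
Lemma sign_perm_inversions n (s : 'S_n) :
  (-1) ^+ s =
    \prod_(i < n) \prod_(j < n | (i < j)%N) (-1) ^+ (s j < s i)%N :> int.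
Proof.
pose v : 'rV[int]_n := \row_i i%:Z.
have sgV (t : 'S_n) : Num.sg (\det (Vandermonde n (col_perm t v))) =
    \prod_(i < n) \prod_(j < n | (i < j)%N) (-1) ^+ (t j < t i)%N.
  rewrite det_Vandermonde (big_morph _ (@sgrM _) (@sgr1 _)).
  apply: eq_bigr => i _; rewrite (big_morph _ (@sgrM _) (@sgr1 _)).
  apply: eq_bigr => j lt_ij; rewrite !mxE.
  have ne_t : t i != t j by rewrite (inj_eq perm_inj) -val_eqE /= ltn_eqF.
  have [lt_t|le_t] := ltnP (t j) (t i).
    by rewrite ltr0_sg // subr_lt0 ltz_nat.
  by rewrite gtr0_sg // subr_gt0 ltz_nat ltn_neqAle le_t andbT.
have V1 : Num.sg (\det (Vandermonde n v)) = 1.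
  rewrite -[v]col_perm1 sgV big1 // => i _; rewrite big1 // => j lt_ij.
  by rewrite !perm1 ltnNge ltnW.
have detV : \det (Vandermonde n (col_perm s v)) =
    (-1) ^+ s * \det (Vandermonde n v).
  have -> : Vandermonde n (col_perm s v) = col_perm s (Vandermonde n v).
    by apply/matrixP=> i j; rewrite !mxE.
  by rewrite col_permE det_mulmx det_perm odd_permV mulrC.
rewrite -sgV detV sgrM V1 mulr1.
by case: (odd_perm s); rewrite ?expr1 ?expr0 ?sgrN1 ?sgr1.
Qed.

(** Listing the columns [f] before the columns [h] creates inversions only between some [f a] and a
    smaller [h j]. Below [h j] lie [j] values of [h], hence [h j - j] values of [f], so [h j]
    accounts for [m - (h j - j)] inversions, which has the parity of [m + h j + j]. *)
Lemma det_col_mx_basis (R : comPzRingType) m k q (hq : (m + k)%N = q)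
    (f : 'I_m -> 'I_q) (h : 'I_k -> 'I_q) (B : 'M[R]_(m, q)) :
    {homo f : i j / (i < j)%N} -> {homo h : i j / (i < j)%N} ->
    (forall i j, f i != h j) ->
  \det (castmx (hq, erefl q) (col_mx B (\matrix_(i, j) (j == h i)%:R))) =
  (-1) ^+ (m * k + \sum_(j < k) (h j + j)) * \det (colsub f B).
Proof.
case: q / hq f h B => f h B f_mono h_mono fh_neq; rewrite castmx_id.
have mono_ltn n (u : 'I_n -> 'I_(m + k)) : {homo u : i j / (i < j)%N} ->
    {mono u : i j / (i < j)%N}.
  move=> u_mono i j; apply/idP/idP; last exact: u_mono.
  case: (ltngtP i j) => // [/u_mono lt_u|/val_inj->]; last by rewrite ltnn.
  by rewrite ltnNge ltnW.
have f_ltn := mono_ltn _ _ f_mono; have h_ltn := mono_ltn _ _ h_mono.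
have inj_ltn n (u : 'I_n -> 'I_(m + k)) :
    {mono u : i j / (i < j)%N} -> injective u.
  move=> u_ltn i j eq_u; apply: val_inj.
  by case: (ltngtP i j) => //; rewrite -u_ltn eq_u ltnn.
have f_inj := inj_ltn _ _ f_ltn; have h_inj := inj_ltn _ _ h_ltn.
pose u i := match split i with inl a => f a | inr b => h b end.
have ul a : u (lshift k a) = f a by rewrite /u (unsplitK (inl _ a)).
have ur b : u (rshift m b) = h b by rewrite /u (unsplitK (inr _ b)).
have u_inj : injective u.
  move=> i j; rewrite -[i]splitK -[j]splitK.
  case: (split i) => a; case: (split j) => b; rewrite /= ?ul ?ur.
  - by move/f_inj->.
  - by move/eqP; rewrite (negPf (fh_neq _ _)).
  - by move/esym/eqP; rewrite (negPf (fh_neq _ _)).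
  - by move/h_inj->.
pose t := perm u_inj.
have sign_t : (-1) ^+ t = (-1) ^+ (m * k + \sum_(j < k) (h j + j)) :> int.
  rewrite sign_perm_inversions big_split_ord /=.
  rewrite [X in _ * X]big1 ?mulr1 => [|b _]; last first.
    rewrite big_split_ord /= big1 ?mul1r => [|a]; last first.
      by rewrite ltnNge (leq_trans (ltnW (ltn_ord a))) ?leq_addr.
    rewrite big1 // => b'; rewrite ltn_add2l !permE !ur h_ltn => lt_b.
    by rewrite ltnNge ltnW.
  under eq_bigr => a _.
    rewrite big_split_ord /= big1 ?mul1r => [|a']; last first.
      by rewrite !permE !ul f_ltn => lt_a; rewrite ltnNge ltnW.
    under eq_bigl => b do rewrite (leq_trans (ltn_ord a)) ?leq_addr //.
    under eq_bigr => b _ do rewrite !permE ul ur.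
    over.
  rewrite exchange_big /= exprD.
  have -> : (-1) ^+ (m * k) = \prod_(j < k) (-1) ^+ m :> int.
    by rewrite prodr_const card_ord exprM.
  rewrite expr_sum -big_split; apply: eq_bigr => j _ /=.
  rewrite -expr_sum -exprD.
  have cnt n i : (\sum_(l < n) (l < i))%N = minn n i.
    elim: n => [|n IHn]; first by rewrite big_ord0 min0n.
    by rewrite big_ord_recr /= IHn; lia.
  (* The indices below [h j] are counted twice: directly, and after reindexing by [t], which
     separates the values of [f] from those of [h]. *)
  have cnt_h : (\sum_(a < m) (f a < h j) + j = h j)%N.
    have := cnt (m + k)%N (h j); rewrite (reindex_inj (@perm_inj _ t)) /=.
    rewrite big_split_ord /=.
    under eq_bigr => a _ do rewrite permE ul.
    under [X in (_ + X)%N]eq_bigr => b _ do rewrite permE ur h_ltn.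
    by rewrite cnt; move: (ltn_ord j) (ltn_ord (h j)); lia.
  have cnt_f : (\sum_(a < m) (f a < h j) + \sum_(a < m) (h j < f a) = m)%N.
    rewrite -big_split /= -[RHS]card_ord -sum1_card; apply: eq_bigr => a _.
    by have := fh_neq a j; rewrite -val_eqE /=; case: ltngtP.
  rewrite -[LHS]signr_odd -[RHS]signr_odd; congr (_ ^+ nat_of_bool _).
  have odd_eq c d l n i :
      (c + l = n -> c + d = i -> odd d = odd (i + (n + l)))%N.
    by move=> <- <-; rewrite !oddD; do 3!case: odd.
  exact: odd_eq cnt_h cnt_f.
(* The inversion count relies on the order of the integers; the resulting sign identity is carried
   to [R] by the ring morphism from [int]. *)
have -> : (-1) ^+ (m * k + \sum_(j < k) (h j + j)) = (-1) ^+ t :> R.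
  have /(congr1 (fun z : int => z%:~R : R)) := sign_t.
  by rewrite !rmorphXn /= rmorphN1.
have -> : col_mx B (\matrix_(i, j) (j == h i)%:R) =
    col_perm t^-1 (block_mx (colsub f B) (colsub h B) 0 1%:M).
  rewrite -[LHS]col_perm1 -(mulVg t) col_permM; congr col_perm.
  apply/matrixP=> i j; rewrite [LHS]mxE.
  rewrite -[i]splitK -[j]splitK; case: (split i) => a; case: (split j) => b /=.
  - by rewrite permE ul block_mxEul col_mxEu mxE.
  - by rewrite permE ur block_mxEur col_mxEu mxE.
  - by rewrite permE ul block_mxEdl col_mxEd !mxE (negPf (fh_neq _ _)).
  - by rewrite permE ur block_mxEdr col_mxEd !mxE inj_eq // eq_sym.
by rewrite col_permE invgK det_mulmx det_perm det_ublock det1 mulr1 mulrC.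
Qed.

(** The values of [enum S] form a subsequence of 0, 1, ..., q - 1. This is the inherited order in
    which rows and columns are listed. *)
Lemma enum_val_ltn q (S : {set 'I_q}) :
  {homo (@enum_val _ (mem S)) : i j / (i < j)%N}.
Proof.
move=> i j lt_ij; have srt : sorted ltn (map val (enum S)).
  apply: (subseq_sorted ltn_trans _ (iota_ltn_sorted 0 q)).
  by rewrite -val_enum_ord map_subseq // enumT filter_subseq.
have lt_size (l : 'I_#|S|) : (l < size (enum S))%N by rewrite -cardE.
have := sorted_ltn_nth ltn_trans 0%N srt i j.
rewrite !inE !size_map => /(_ (lt_size _) (lt_size _) lt_ij).
by rewrite !(nth_map (enum_val i)) // -!enum_val_nth.
Qed.

(** * Reduced incidence matrices of multigraphs *)

Section ReducedIncidence.
Variables (W E : finType) (H : multigraph W E) (m : nat).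
Variables (C : 'I_m.+1 -> W) (s : 'I_m -> E).

(** For injective [C] the vertex [C ord0] gets the zero vector, which encodes the deletion of its
    row. *)
Definition vertex_col (R : pzRingType) (w : W) : 'cV[R]_m :=
  \col_a (w == C (lift ord0 a))%:R.

Definition incidence_mx (R : pzRingType) : 'M[R]_m :=
  \matrix_(a, j) (vertex_col R (mg_tgt H (s j)) a 0
                  - vertex_col R (mg_src H (s j)) a 0).

(** The 1-chain of a single step, signed by its direction; [incidence_mx] acts on such chains as the
    reduced boundary map. *)
Definition step_col (R : pzRingType) (st : E * bool) : 'cV[R]_m :=
  \col_j ((-1) ^+ (~~ st.2) * (s j == st.1)%:R).

Hypothesis s_inj : injective s.

Lemma incidence_mx_step (R : comPzRingType) j b :
  incidence_mx R *m step_col R (s j, b) =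
  vertex_col R (step_tgt H (s j, b)) - vertex_col R (step_src H (s j, b)).
Proof.
apply/colP=> a; rewrite !mxE (bigD1 j) //= big1 => [|i ne_ij].
  rewrite !mxE /step_tgt /step_src /= eqxx addr0 mulr1; case: b => /=.
    by rewrite mulr1.
  by rewrite mulrN1 opprB.
by rewrite !mxE /= inj_eq // (negPf ne_ij) !mulr0.
Qed.

(** The boundaries of consecutive steps telescope; a closed walk therefore yields a kernel
    vector. *)
Lemma incidence_mx_walk (R : comPzRingType) st p :
  all (fun st => st.1 \in codom s) (st :: p) ->
  path (fun st st' => step_tgt H st == step_src H st') st p ->
  incidence_mx R *m (\sum_(st' <- st :: p) step_col R st') =
  vertex_col R (step_tgt H (last st p)) - vertex_col R (step_src H st).
Proof.
elim: p st => [|st' p IHp] [z b] /=.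
  rewrite andbT big_seq1 => /codomP[j ->] _.
  exact: incidence_mx_step.
case/andP=> /codomP[j ->] allp /andP[/eqP eq_st walk_p].
rewrite big_cons mulmxDr incidence_mx_step IHp // addrC eq_st.
by rewrite addrA subrK.
Qed.

Definition used_edges : {set E} := [set s j | j : 'I_m].

Lemma used_edgesE z : (z \in used_edges) = (z \in codom s).
Proof. by apply/imsetP/codomP => [[j _ ->]|[j ->]]; exists j. Qed.

Lemma mg_adj_sym (T : {set E}) : symmetric (mg_adj H T).
Proof.
suff imp u v : mg_adj H T u v -> mg_adj H T v u.
  by move=> u v; apply/idP/idP; apply: imp.
case/existsP=> -[z b] /and3P[/= zT /eqP <- /eqP <-]; apply/existsP.
by exists (z, ~~ b); rewrite zT; case: b; rewrite !eqxx.
Qed.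

(** The witness is the sum of the signed steps along a path from [u] to [v]. *)
Lemma incidence_mx_connect (R : comPzRingType) u v :
    connect (mg_adj H used_edges) u v ->
  exists z, incidence_mx R *m z = vertex_col R v - vertex_col R u.
Proof.
case/connectP=> p; elim: p u => [|w p IHp] u /=.
  by move=> _ ->; exists 0; rewrite mulmx0 subrr.
case/andP=> /existsP[[z b] /and3P[/imsetP[j _ /= ->]]].
move=> /eqP <- /eqP <- walk_p v_last.
have [y Dy] := IHp _ walk_p v_last.
exists (y + step_col R (s j, b)).
by rewrite mulmxDr Dy incidence_mx_step addrA subrK.
Qed.

Hypothesis C_inj : injective C.
Hypothesis C_im : [set C a | a : 'I_m.+1] = mg_vertices H.
Hypothesis H_src : forall z, mg_src H z \in mg_vertices H.
Hypothesis H_tgt : forall z, mg_tgt H z \in mg_vertices H.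

Lemma C_vertex a : C a \in mg_vertices H.
Proof. by rewrite -C_im imset_f. Qed.

Lemma det_incidence_mx_connected (R : comPzRingType) :
    mg_connected H used_edges ->
  \det (incidence_mx R) = 1 \/ \det (incidence_mx R) = -1.
Proof.
move=> connH.
(* Working over [int] is what restricts the determinant: the only units there are 1 and -1. The
   subtracted vector is zero, so the [y a] are the columns of a right inverse. *)
have /fin_all_exists[y Dy] a : exists y,
    incidence_mx int *m y =
    vertex_col int (C (lift ord0 a)) - vertex_col int (C ord0).
  by apply: incidence_mx_connect; apply: connH; apply: C_vertex.
have AY1 : incidence_mx int *m \matrix_(i, a) y a i 0 = 1%:M.
  apply/matrixP=> i a; rewrite !mxE.
  transitivity ((incidence_mx int *m y a) i 0).
    by rewrite mxE; apply: eq_bigr => j _; rewrite [X in _ * X]mxE.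
  rewrite Dy !mxE !(inj_eq C_inj) (inj_eq (@lift_inj _ _)).
  by rewrite (negPf (neq_lift _ _)) subr0 eq_sym.
have [unitA _] := mulmx1_unit AY1; rewrite unitmxE in unitA.
have -> : incidence_mx R = map_mx intr (incidence_mx int).
  by apply/matrixP=> i j; rewrite !mxE rmorphB /= !rmorph_nat.
rewrite det_map_mx.
by move: unitA; case/orP=> /eqP->; [left | right]; rewrite ?rmorphN rmorph1.
Qed.

Lemma connected_det_incidence_mx (R : idomainType) :
  \det (incidence_mx R) != 0 -> mg_connected H used_edges.
Proof.
move=> det_neq0; set conn := connect (mg_adj H used_edges).
have conn_sym : symmetric conn by exact/sym_connect_sym/mg_adj_sym.
have conn0 w : w \in mg_vertices H -> conn (C ord0) w.
  pose y : 'rV[R]_m := \row_a (~~ conn (C ord0) (C (lift ord0 a)))%:R.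
  (* This holds at [C ord0] as well: its vector is zero, and it reaches itself. *)
  have yE w' : w' \in mg_vertices H ->
      \sum_a y 0 a * vertex_col R w' a 0 = (~~ conn (C ord0) w')%:R.
    rewrite -C_im => /imsetP[a' _ ->].
    have [a ->|->] := unliftP ord0 a'.
      rewrite (bigD1 a) //= big1 => [|i ne_ia].
        by rewrite !mxE eqxx mulr1 addr0.
      rewrite !mxE inj_eq // (inj_eq (@lift_inj _ _)) eq_sym.
      by rewrite (negPf ne_ia) mulr0.
    rewrite /conn connect0 big1 // => i _.
    by rewrite !mxE inj_eq // (negPf (neq_lift _ _)) mulr0.
  have yA0 : y *m incidence_mx R = 0.
    apply/rowP=> j; rewrite !mxE.
    under eq_bigr => a _ do rewrite [X in _ * X]mxE mulrBr.
    rewrite sumrB !yE //.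
    suff -> : conn (C ord0) (mg_tgt H (s j)) = conn (C ord0) (mg_src H (s j)).
      by rewrite subrr.
    rewrite ![conn (C ord0) _]conn_sym.
    apply: same_connect; first exact/sym_connect_sym/mg_adj_sym.
    (* The edge is traversed backwards, from target to source. *)
    apply: connect1; apply/existsP; exists (s j, false).
    by rewrite /= used_edgesE codom_f !eqxx.
  have y0 : y = 0.
    apply/eqP/negPn/negP=> y_neq0; case/negP: det_neq0.
    by apply/det0P; exists y.
  move=> wH; apply/negPn/negP=> nconn.
  have := yE w wH; rewrite y0 nconn big1 => [/esym/eqP|a _].
    by rewrite oner_eq0.
  by rewrite mxE mul0r.
move=> u v uH vH; apply: connect_trans (conn0 v vH).
by rewrite -/conn conn_sym conn0.
Qed.

Lemma acyclic_det_incidence_mx (R : idomainType) :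
  \det (incidence_mx R) != 0 -> mg_acyclic H used_edges.
Proof.
move=> det_neq0 [[]//|st p [_ edges_c cyc_c _ uniq_c]].
(* [det0P] provides a left kernel, whereas the cycle gives a right kernel vector, hence the
   transposes. *)
case/negP: det_neq0; rewrite -det_tr; apply/det0P.
pose z := \sum_(st' <- st :: p) step_col R st'.
exists z^T; last first.
  apply: trmx_inj; rewrite -trmx_mul trmxK trmx0.
  rewrite [LHS]incidence_mx_walk.
  - move: cyc_c; rewrite /= rcons_path => /andP[_ /eqP->].
    by rewrite subrr.
  - by apply: sub_all edges_c => st'; rewrite used_edgesE.
  by move: cyc_c; rewrite /= rcons_path => /andP[].
have [j Dj] : exists j, st.1 = s j.
  by move: edges_c => /= /andP[/imsetP[j _ ?] _]; exists j.
apply/negP=> /eqP/(congr1 (fun y : 'rV_m => y 0 j)).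
(* The edges of the cycle are distinct, so at the coordinate of its first edge only the first step
   contributes, with value 1 or -1. *)
rewrite !mxE /z big_cons mxE summxE big_seq big1 => [/eqP|st' p_st'].
  by rewrite !mxE Dj eqxx mulr1 addr0 signr_eq0.
rewrite !mxE -Dj; case: eqP => [eq_st|_]; last by rewrite mulr0.
by move: uniq_c => /= /andP[]; rewrite eq_st map_f.
Qed.

Lemma det_incidence_mx_tree (R : idomainType) :
  \det (incidence_mx R) != 0 <-> mg_spanning_tree H used_edges.
Proof.
split=> [det_neq0 | [connH _]].
  split; first exact: connected_det_incidence_mx det_neq0.
  exact: acyclic_det_incidence_mx det_neq0.
by case: (det_incidence_mx_connected R connH) => ->; rewrite ?oppr_eq0 oner_eq0.
Qed.

End ReducedIncidence.

(** * Parity of the orientation sign *)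

Lemma homo_ltn_ord_geq k q (h : 'I_k -> 'I_q) :
  {homo h : i j / (i < j)%N} -> forall j : 'I_k, (j <= h j)%N.
Proof.
move=> h_mono [j ltjk]; elim: j ltjk => // j IHj ltjk /=.
exact: leq_ltn_trans (IHj (ltnW ltjk))
  (h_mono (Ordinal (ltnW ltjk)) (Ordinal ltjk) _).
Qed.

(** With q = m + k, the exponent k(q + 1) equals mk + k(k + 1), which has the parity of mk; and the
    sums of [enum_val j - j] and of [enum_val j + j] differ by an even number. *)
Lemma orientation_signE (R : realType) q (I : {set 'I_q}) :
  (-1) ^+ (#|I| * q.+1) * orientation_sign R I =
  (-1) ^+ ((q - #|I|) * #|I| + \sum_(j < #|I|) (enum_val j + j)).
Proof.
rewrite /orientation_sign big_enum_val -exprD.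
(* Writing the triangular number as a sum allows a termwise subtraction, in which no term
   truncates. *)
have sumS k : ((k * k.+1)./2 = \sum_(j < k) j.+1)%N.
  elim: k => [|k IHk]; first by rewrite big_ord0.
  by rewrite big_ord_recr /= -IHk; lia.
have le_enum (j : 'I_#|I|) : (j <= enum_val j)%N.
  exact: (homo_ltn_ord_geq (@enum_val_ltn q I)).
rewrite sumS -sumnB => [|j _]; last by rewrite ltnS le_enum.
have -> : (\sum_(j < #|I|) (enum_val j + j) =
    \sum_(j < #|I|) ((enum_val j).+1 - j.+1) + (\sum_(j < #|I|) j).*2)%N.
  rewrite -addnn -!big_split; apply: eq_bigr => j _ /=.
  by rewrite subSS addnA subnK ?le_enum.
have := subn_card_ordK I.
move: (\sum_i (_ - _))%N (\sum_(j < #|I|) j)%N (q - #|I|)%N => d c m.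
move: #|I| => k <-.
rewrite -[LHS]signr_odd -[RHS]signr_odd; congr (_ ^+ nat_of_bool _).
rewrite !(oddD, oddM, oddS) odd_double.
by case: (odd m); case: (odd k); case: (odd d).
Qed.

(** * The quotient matrix as a reduced incidence matrix *)

(** Leaving out the index [g] loses nothing because [g] is outside [A]; for [w = g] both sides are
    0, in accordance with e_g = 0. *)
Lemma sum_enum_val_setC1 (R : pzRingType) (V : finType) (g : V) (A : {set V}) w :
    g \notin A ->
  \sum_(v < #|[set~ g]|) (enum_val v \in A)%:R * (enum_val v == w)%:R
    = (w \in A)%:R :> R.
Proof.
move=> gA; rewrite -(big_enum_val (fun v => (v \in A)%:R * (v == w)%:R)) /=.
have [w_g | w_ng] := eqVneq w g.
  rewrite w_g (negPf gA) big1 // => v; rewrite !inE => /negPf->.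
  by rewrite mulr0.
rewrite (bigD1 w) ?inE //= eqxx mulr1 big1 ?addr0 // => v /andP[_ /negPf->].
by rewrite mulr0.
Qed.

Section QuotientIncidence.
Variables (R : realType) (V : finType) (P : {set {set V}}).
Variables (root : {set V} -> V) (g : V) (q : nat) (x : 'I_q -> V).
Variables (m : nat) (F : rel V) (C : 'I_m.+1 -> {set V}).
Hypotheses (F_sym : symmetric F) (C_num : component_numbering F g C).

Lemma components_partition : partition (components F) [set: V].
Proof.
apply: equivalence_partitionP => u v w _ _ _; split=> [|uv].
  exact: connect0.
exact: same_connect (sym_connect_sym F_sym) _ _ uv _.
Qed.

Lemma pblock_component_eq a v :
  (pblock (components F) v == C a) = (v \in C a).
Proof.
have [_ C_im _] := C_num.
have /and3P[/eqP coverF tiF _] := components_partition.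
have C_comp : C a \in components F by rewrite -C_im imset_f.
apply/eqP/idP => [<-|]; last exact: def_pblock.
by rewrite mem_pblock coverF inE.
Qed.

Lemma component_mem v : pblock (components F) v \in components F.
Proof.
have /and3P[/eqP coverF _ _] := components_partition.
by rewrite pblock_mem // coverF inE.
Qed.

Lemma ground_notin_component a : g \notin C (lift ord0 a).
Proof.
have [C_inj _ g0] := C_num.
move: g0; rewrite -!pblock_component_eq => /eqP->.
by rewrite (inj_eq C_inj) neq_lift.
Qed.

(** Summing d_x over a component other than C_0 tests whether it contains x, minus whether it
    contains r(x): this is the incidence entry of the edge x of H_F. *)
Lemma quotient_mxE (s : 'I_m -> 'I_q) :
  colsub s (quotient_mx R P root g x C) =
  incidence_mx (quotient_port_graph P root x F) C s R.
Proof.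
apply/matrixP=> a j; rewrite !mxE.
under eq_bigr => v _ do rewrite !mxE mulrBr.
rewrite sumrB !sum_enum_val_setC1 ?ground_notin_component //=.
by rewrite !pblock_component_eq.
Qed.

End QuotientIncidence.

(** * The completed determinant of a spanning forest *)

Theorem lemma3p3 (R : realType) (V : finType) (e : rel V)
    (e_simple : simple_graph e) (e_conn : connected_graph e)
    (M : {set V}) (M_neq0 : M != set0)
    (P : {set {set V}}) (P_part : partition P M)
    (root : {set V} -> V) (rootP : forall A, A \in P -> root A \in A)
    (g : V) (g_root : g \in port_roots P root)
    (q : nat) (x : 'I_q -> V) (x_inj : injective x)
    (x_N : [set x i | i : 'I_q] = M :\: port_roots P root)
    (I : {set 'I_q})
    (F : rel V) (F_forest : spanning_forest e (q - #|I|).+1 F)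
    (C : 'I_(q - #|I|).+1 -> {set V}) (C_num : component_numbering F g C) :
  let k := #|I| in
  let chihat : R := chi_hat R P root g x C (subn_card_ordK I) in
  [/\ [\/ chihat = 0, chihat = 1 | chihat = -1],
      chihat != 0 <-> mg_spanning_tree (quotient_port_graph P root x F) (~: I) &
      chihat = (-1) ^+ (k * q.+1) * orientation_sign R I
               * chi R P root g x C (card_setC_ord I)].
Proof.
move=> k chihat; have [F_sym _ _ _] := F_forest; have [C_inj C_im _] := C_num.
(* The complement of [I] in inherited order, with its size recast to the number of rows of B_F. *)
pose s (j : 'I_(q - #|I|)) : 'I_q :=
  enum_val (cast_ord (esym (card_setC_ord I)) j).
have s_inj : injective s by apply: inj_comp enum_val_inj (@cast_ord_inj _ _ _).
have s_im : used_edges s = ~: I.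
  apply/setP=> i; apply/imsetP/idP => [[j _ ->]|Ii]; first exact: enum_valP.
  exists (cast_ord (card_setC_ord I) (enum_rank_in Ii i)) => //.
  by rewrite /s cast_ordK enum_rankK_in.
set H := quotient_port_graph P root x F.
have chiE : chi R P root g x C (card_setC_ord I) = \det (incidence_mx H C s R).
  rewrite -(quotient_mxE R P root x F_sym C_num); congr (\det _).
  by apply/matrixP=> a j; rewrite castmxE !mxE cast_ord_id.
have chihatE : chihat = (-1) ^+ (k * q.+1) * orientation_sign R I
               * chi R P root g x C (card_setC_ord I).
  rewrite orientation_signE chiE -(quotient_mxE R P root x F_sym C_num).
  rewrite -(det_col_mx_basis (subn_card_ordK I)).
  - rewrite /chihat /chi_hat; congr (\det (castmx _ (col_mx _ _))).
    by apply/matrixP=> i j; rewrite !mxE.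
  - by move=> i j lt_ij; apply: enum_val_ltn.
  - exact: enum_val_ltn.
  move=> i j; apply: contraTneq (enum_valP j) => <-.
  by rewrite -in_setC enum_valP.
have H_src z : mg_src H z \in mg_vertices H by apply: component_mem.
have H_tgt z : mg_tgt H z \in mg_vertices H by apply: component_mem.
have treeE := det_incidence_mx_tree (H := H) s_inj C_inj C_im H_src H_tgt R.
rewrite s_im -chiE in treeE.
(* The two determinants differ by a power of -1, so they vanish together. *)
have chihat_neq0 : (chihat != 0) = (chi R P root g x C (card_setC_ord I) != 0).
  by rewrite chihatE /orientation_sign -exprD mulf_eq0 signr_eq0.
split=> //; last by rewrite chihat_neq0.
have [->|chi_neq0] := eqVneq chihat 0; first by constructor 1.
rewrite chihat_neq0 in chi_neq0.
(* A nonzero value forces connectedness, which in turn forces the value to be 1 or -1. *)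
have [connH _] := treeE.1 chi_neq0; rewrite -s_im in connH.
rewrite chihatE /orientation_sign -exprD -signr_odd chiE.
have [->|->] := det_incidence_mx_connected (H := H) s_inj C_inj C_im R connH;
  case: odd; rewrite ?mulr1 ?mulrN1 ?expr0 ?expr1 ?opprK;
  by [constructor 2 | constructor 3].
Qed.
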